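(* Let $\mathfrak g$ be a simple finite dimensional complex Lie algebra, $\delta:\mathfrak g[x]\to(\mathfrak g\otimes\mathfrak g)[x,y]$ a Lie bialgebra structure on $\mathfrak g[x]$ and $\overline\delta$ its extension to $\mathfrak g[[x]]$. Assume that $D(\mathfrak g[[x]],\overline\delta)=\mathfrak g((x))\oplus\mathfrak g[\varepsilon]$, $\varepsilon^2=0$, with canonical form $$(f_1+g_1\varepsilon+h_1\,|\,f_2+g_2\varepsilon+h_2)=t(K'(f_1,f_2))-K(g_1,h_2)-K(h_1,g_2)-c_1K(h_1,h_2),$$ where $t:\mathbb C((x))\to\mathbb C$ satisfies $t(x^k)=0$ for $k\ge2$, $t(x)=1$, $t(1)=c_1$, $t(x^{-k})=c_{k+1}$ for $k\ge1$, and put $c(x)=1+c_1x+c_2x^2+\cdots$. Let $\mathfrak g((x))\oplus\mathfrak g[\varepsilon]=\mathfrak g[[x]]\oplus W$ be the corresponding Manin triple. Assume that $\sigma(x)\in\mathrm{Aut}_{\mathbb C[x]}(\mathfrak g[x])$ and a vertex $\alpha_i$ of the extended Dynkin diagram of $\mathfrak g$ are such that $$\sigma(x)\bigl(W(\mathbb C[[x^{-1}]]\oplus\mathbb C)\bigr)\subset\mathbb O_{\alpha_i}\oplus\mathfrak g[\varepsilon].$$ Then: - $c(x)=1$ if $k_i=1$; - if $k_i>1$, then $\mathbb O_{\alpha_i}\oplus\mathfrak g[\varepsilon]$ does not contain Lagrangian subalgebras (so this case does not occur).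
   Context: Lie bialgebra structure: $\delta:L\to L\otimes L$ is a derivation into the $L$-module $L\otimes L$ inducing a Lie algebra structure on the dual space. For $L=\mathfrak g[[x]]$ one uses the topological tensor square $(\mathfrak g\otimes\mathfrak g)[[x,y]]$ and $L^*=$ the space of distributions (functionals vanishing on $x^m\mathfrak g[[x]]$ for some $m$). A structure $\delta$ on $\mathfrak g[x]$ extends to $\mathfrak g[[x]]$ by $\overline\delta(\sum a_nx^n)=\sum\delta(a_nx^n)$. The Drinfeld double $D(L,\delta)=L\oplus L^*$ carries the symmetric form with $L,L^*$ isotropic and $(a|f)=f(a)$, and the unique Lie bracket extending those of $L$ and $L^*$ and making the form invariant. The equality $D(\mathfrak g[[x]],\overline\delta)=\mathfrak g((x))\oplus\mathfrak g[\varepsilon]$ (direct sum of Lie algebras) is an isomorphism preserving forms (up to a nonzero scalar), under which $\mathfrak g[[x]]$ is embedded by $a_0+a_1x+a_2x^2+\cdots\mapsto(a_0+a_1x+a_2x^2+\cdots)\oplus(a_0+a_1\varepsilon)$. $K$ is the Killing form of $\mathfrak g$, $K'$ that of $\mathfrak g((x))$ over $\mathbb C((x))$. $W$ is the image of $\mathfrak g[[x]]^*$: a Lagrangian subalgebra ($W=W^\perp$) complementary to $\mathfrak g[[x]]$. It is known that $W\subset x^N\mathfrak g[x^{-1}]\oplus\mathfrak g[\varepsilon]$ for some $N$, so $W\subset\mathfrak g((x^{-1}))\oplus\mathfrak g[\varepsilon]$; $W(\mathbb C[[x^{-1}]]\oplus\mathbb C)$ is the span of products of elements of $W$ with elements of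 the ring $\mathbb C[[x^{-1}]]\oplus\mathbb C$ acting componentwise. A $\mathbb C[x]$-linear Lie automorphism $\sigma(x)$ of $\mathfrak g[x]$ acts naturally on $\mathfrak g((x^{-1}))$ and, through reduction modulo $x^2$ ($x\mapsto\varepsilon$), on $\mathfrak g[\varepsilon]$. ''Lagrangian subalgebra contained in $\mathbb O_{\alpha_i}\oplus\mathfrak g[\varepsilon]$'' means a subalgebra of the double equal to its orthogonal complement and contained in $(\mathbb O_{\alpha_i}\cap\mathfrak g[x,x^{-1}])\oplus\mathfrak g[\varepsilon]$. Fix a Cartan subalgebra $\mathfrak h$, root system $R$, simple roots $\alpha_1,\dots,\alpha_\ell$ ($\ell=\mathrm{rank}\,\mathfrak g$), maximal root $\alpha_{\max}=\sum_{j\ge1}k_j\alpha_j$, $\alpha_0=-\alpha_{\max}$, $k_0=1$. For $h\in\mathfrak h(\mathbb R)$ put $\mathbb O_h=\mathfrak h[[x^{-1}]]\oplus\bigoplus_{\alpha\in R}M_\alpha(h)\mathfrak g_\alpha$, where $M_\alpha(h)=\{f\in\mathbb C((x^{-1})):v(f)\ge\alpha(h)\}$ and $v(\sum_{k\ge n}a_kx^{-k})=n$ if $a_n\ne0$. Let $h_0=0$ and, for $i\ge1$, let $h_i$ be defined by $\alpha_j(h_i)=\delta_{ij}/k_i$ ($j\ge1$). Then $\mathbb O_{\alpha_i}:=\mathbb O_{h_i}$. *)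

(* Defs.v *)
From HB Require Import structures.
From mathcomp Require Export all_boot all_order all_algebra.
From mathcomp Require Export all_classical reals.
From mathcomp Require Export complex.

Set Implicit Arguments.
Unset Strict Implicit.
Unset Printing Implicit Defensive.

Import Order.TTheory GRing.Theory Num.Theory.
Local Open Scope classical_set_scope.
Local Open Scope ring_scope.

(* Bilinear alternating brackets with the Jacobi identity on a linear
   subspace S of V. *)
Definition lie_bracket_on (F : fieldType) (V : lmodType F) (S : set V)
    (br : V -> V -> V) : Prop :=
  [/\ forall u v, S u -> S v -> S (br u v),
      forall (a : F) u v w, S u -> S v -> S w ->
        br (a *: u + v) w = a *: br u w + br v w,
      forall (a : F) u v w, S u -> S v -> S w ->
        br w (a *: u + v) = a *: br w u + br w v,
      forall u, S u -> br u u = 0 &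
      forall u v w, S u -> S v -> S w ->
        br u (br v w) + br v (br w u) + br w (br u v) = 0].

HB.mixin Record Lmodule_isLie (F : fieldType) V of GRing.Lmodule F V := {
  lie : V -> V -> V;
  lieP : lie_bracket_on setT lie
}.

#[short(type="finLieAlgType")]
HB.structure Definition FinLieAlg (F : fieldType) :=
  {V of Vector F V & Lmodule_isLie F V}.

Section FiniteDimensional.
Variables (F : fieldType) (g : finLieAlgType F).
Implicit Types (u v w : g) (U V H : {vspace g}).

Lemma lie_linearl (a : F) u v w :
  lie (a *: u + v) w = a *: lie u w + lie v w.
Proof. by have [_ + _ _ _] := @lieP F g; apply. Qed.

Lemma lie_linearr (a : F) u v w :
  lie w (a *: u + v) = a *: lie w u + lie w v.
Proof. by have [_ _ + _ _] := @lieP F g; apply. Qed.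

Lemma lie0u u : lie 0 u = 0.
Proof.
have := lie_linearl 1 0 0 u; rewrite !scale1r addr0 => /esym/eqP.
by rewrite -[X in _ == X]addr0 (inj_eq (addrI _)) => /eqP.
Qed.

Lemma lieu0 u : lie u 0 = 0.
Proof.
have := lie_linearr 1 0 0 u; rewrite !scale1r addr0 => /esym/eqP.
by rewrite -[X in _ == X]addr0 (inj_eq (addrI _)) => /eqP.
Qed.

Definition is_ideal V := forall u v, v \in V -> lie u v \in V.

Definition simple_lie : Prop :=
  (exists u v, lie u v != 0) /\
  (forall V, is_ideal V -> V = 0%VS \/ V = fullv).

Definition bas (i : 'I_(\dim {:g})) : g := (vbasis {:g})`_i.
Definition bcoord (i : 'I_(\dim {:g})) u : F := coord (vbasis {:g}) i u.

(* trace of ad u \o ad v *)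
Definition killing u v : F := \sum_i bcoord i (lie u (lie v (bas i))).

Definition lie_prod U V : {vspace g} :=
  <<[seq lie u v | u <- vbasis U, v <- vbasis V]>>%VS.

(* Nilpotent (the lower central series vanishes) and self-normalizing
   subalgebra. *)
Definition is_cartan H : Prop :=
  [/\ (lie_prod H H <= H)%VS,
      exists n, iter n (lie_prod H) H = 0%VS &
      forall u, (forall v, v \in H -> lie u v \in H) -> u \in H].

Section Roots.
Variable H : {vspace g}.
Local Notation dual := 'Hom(subvs_of H, F^o).

Definition root_space (alpha : dual) : set g :=
  [set u | forall t : subvs_of H, lie (vsval t) u = (alpha t : F) *: u].

Definition is_root (alpha : dual) : Prop :=
  alpha != 0 /\ exists2 u, u != 0 & root_space alpha u.

Definition nneg_comb (l : nat) (alpha : l.-tuple dual) (beta : dual) : Prop :=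
  exists n : 'I_l -> nat, beta = \sum_j (n j)%:R *: tnth alpha j.

Definition simple_roots (alpha : (\dim H).-tuple dual) : Prop :=
  [/\ basis_of fullv alpha,
      forall j, is_root (tnth alpha j) &
      forall beta, is_root beta -> nneg_comb alpha beta \/ nneg_comb alpha (- beta)].

Definition maximal_root (alpha : (\dim H).-tuple dual) (theta : dual) : Prop :=
  is_root theta /\ forall beta, is_root beta -> nneg_comb alpha (theta - beta).

End Roots.
End FiniteDimensional.

Section LinearSpan.
Variables (F : fieldType) (V : lmodType F).

Definition lspan (A : set V) : set V :=
  [set v | exists n (a : 'I_n -> F) (w : 'I_n -> V),
     (forall i, A (w i)) /\ v = \sum_i a i *: w i].

Definition is_subspace (A : set V) : Prop :=
  A 0 /\ forall (a : F) u v, A u -> A v -> A (a *: u + v).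

End LinearSpan.

(* [nat -> g] is g[[x]]: the coefficient of x^n is [a n]. *)
Section Polynomials.
Variables (F : fieldType) (g : finLieAlgType F).

Definition gmono (n : nat) (u : g) : nat -> g :=
  fun m => if m == n then u else 0.

Definition conv (U V : zmodType) (B : U -> V -> g) (a : nat -> U) (b : nat -> V)
  : nat -> g := fun n => \sum_(i < n.+1) B (a i) (b (n - i)%N).

Definition ps_lie (a b : nat -> g) : nat -> g := conv (@lie F g) a b.

Definition fin_poly (V : zmodType) : {pred nat -> V} :=
  fun a => `[< exists N, forall n, (N <= n)%N -> a n = 0 >].

Lemma fin_poly_submod : submod_closed (@fin_poly g).
Proof.
split=> [|a p q /asboolP[M pM] /asboolP[N qN]]; apply/asboolP.
  by exists 0%N.
exists (maxn M N) => n; rewrite geq_max => /andP[Mn Nn].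
by rewrite !fctE pM// qN// scaler0 addr0.
Qed.

HB.instance Definition _ :=
  GRing.isSubmodClosed.Build F (nat -> g) (@fin_poly g) fin_poly_submod.

Lemma fin_poly_conv (U V : zmodType) (B : U -> V -> g) a b :
  (forall v, B 0 v = 0) -> (forall u, B u 0 = 0) ->
  a \in @fin_poly U -> b \in @fin_poly V -> conv B a b \in @fin_poly g.
Proof.
move=> B0 B1 /asboolP[M aM] /asboolP[N bN]; apply/asboolP.
exists (M + N)%N => n MNn; rewrite /conv big1// => i _.
have [/aM->//|iM] := leqP M i.
rewrite [b _]bN// leq_subRL; first by rewrite (leq_trans _ MNn)// leq_add2r ltnW.
by rewrite -ltnS.
Qed.

Lemma fin_poly_mono n u : gmono n u \in @fin_poly g.
Proof.
apply/asboolP; exists n.+1 => m nm.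
by rewrite /gmono gtn_eqF.
Qed.

Lemma fin_poly_coef (p : {poly F}) : (fun n => p`_n) \in @fin_poly F.
Proof. by apply/asboolP; exists (size p) => n /(nth_default 0). Qed.

End Polynomials.

(* g[x] *)
Record gpoly (F : fieldType) (g : finLieAlgType F) := GPoly {
  gcoef : nat -> g;
  gcoefP : gcoef \in @fin_poly g }.
Arguments gpoly {F} g.

HB.instance Definition _ (F : fieldType) (g : finLieAlgType F) :=
  [isSub for @gcoef F g].
HB.instance Definition _ (F : fieldType) (g : finLieAlgType F) :=
  [Choice of gpoly g by <:].
HB.instance Definition _ (F : fieldType) (g : finLieAlgType F) :=
  [SubChoice_isSubLmodule of gpoly g by <:].

Section PolynomialLie.
Variables (F : fieldType) (g : finLieAlgType F).
Implicit Types a b : gpoly g.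

Definition gX n (u : g) : gpoly g := GPoly (fin_poly_mono n u).

Definition gpoly_lie a b : gpoly g :=
  GPoly (fin_poly_conv (@lie0u F g) (@lieu0 F g) (gcoefP a) (gcoefP b)).

Definition gpoly_scale (p : {poly F}) a : gpoly g :=
  GPoly (fin_poly_conv (@scale0r F g) (@scaler0 F g) (fin_poly_coef p) (gcoefP a)).

Definition is_polyAut (sigma : gpoly g -> gpoly g) : Prop :=
  [/\ forall (p : {poly F}) a b,
        sigma (gpoly_scale p a + b) = gpoly_scale p (sigma a) + sigma b,
      forall a b, sigma (gpoly_lie a b) = gpoly_lie (sigma a) (sigma b) &
      bijective sigma].

End PolynomialLie.

Section Bialgebra.
Variables (F : fieldType) (g : finLieAlgType F).

(* g (x) g, in the coordinates of the basis [bas]: the matrix T stands for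
   \sum_(i, j) T i j (e_i (x) e_j). *)
Definition gtens : Type := 'M[F]_(\dim {:g}).
HB.instance Definition _ := GRing.Lmodule.on gtens.
HB.instance Definition _ := Choice.on gtens.

Definition tens (u v : g) : gtens := \matrix_(i, j) (bcoord i u * bcoord j v).

Definition adl (u : g) (T : gtens) : gtens :=
  \sum_i \sum_j T i j *: tens (lie u (bas i)) (bas j).
Definition adr (u : g) (T : gtens) : gtens :=
  \sum_i \sum_j T i j *: tens (bas i) (lie u (bas j)).

(* (g (x) g)[[x, y]]: the coefficient of x^m y^n is [T m n]. *)
Definition gtens2 : Type := nat -> nat -> gtens.
HB.instance Definition _ := GRing.Lmodule.on gtens2.
HB.instance Definition _ := Choice.on gtens2.

Definition poly2 (T : gtens2) : Prop :=
  exists N, forall m n, (N <= m)%N || (N <= n)%N -> T m n = 0.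

(* [a(x) (x) 1 + 1 (x) a(y), T] *)
Definition act2 (a : nat -> g) (T : gtens2) : gtens2 := fun m n =>
  \sum_(k < m.+1) adl (a k) (T (m - k)%N n) +
  \sum_(k < n.+1) adr (a k) (T m (n - k)%N).

(* (f (x) h)(T), where [f n u] and [h n u] are the values of the functionals
   on u x^n.  The sum is finite if T is polynomial, or if f and h are
   distributions. *)
Definition pairing2 (f h : nat -> g -> F) (T : gtens2) : F :=
  \sum_(mn \in [set: nat * nat])
    \sum_i \sum_j T mn.1 mn.2 i j * f mn.1 (bas i) * h mn.2 (bas j).

Definition is_bialgebra (delta : gpoly g -> gtens2) : Prop :=
  [/\ linear delta,
      forall a, poly2 (delta a),
      forall a b, delta (gpoly_lie a b) =
                  act2 (gcoef a) (delta b) - act2 (gcoef b) (delta a) &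
      @lie_bracket_on F (gpoly g -> F^o) [set f | linear f]
        (fun f h a => pairing2 (fun n u => f (gX n u)) (fun n u => h (gX n u))
                               (delta a))].

(* delta(\sum_k a_k x^k) = \sum_k delta(a_k x^k); every coefficient of the
   right-hand side is a finite sum, as delta is a 1-cocycle and g is perfect. *)
Definition delta_ext (delta : gpoly g -> gtens2) (a : nat -> g) : gtens2 :=
  fun m n => \sum_(k \in [set: nat]) delta (gX k (a k)) m n.

End Bialgebra.

Section Distributions.
Variables (F : fieldType) (g : finLieAlgType F).

Definition is_distr : {pred (nat -> g) -> F^o} := fun f =>
  `[< linear f /\
      exists m, forall a, (forall k, (k < m)%N -> a k = 0) -> f a = 0 >].

Lemma is_distr_submod : submod_closed is_distr.
Proof.
split=> [|c f h /asboolP[fl [M fM]] /asboolP[hl [N hN]]]; apply/asboolP.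
  split; first by move=> a u v; rewrite !fctE scaler0 addr0.
  by exists 0%N.
split=> [a u v|].
  rewrite !fctE fl hl !scalerDr !scalerA [c * a]mulrC.
  by rewrite addrACA.
exists (maxn M N) => a ha; rewrite !fctE fM ?hN ?scaler0 ?addr0//.
- by move=> k kN; apply: ha; rewrite leq_max kN orbT.
- by move=> k kM; apply: ha; rewrite leq_max kM.
Qed.

HB.instance Definition _ :=
  GRing.isSubmodClosed.Build F ((nat -> g) -> F^o) is_distr is_distr_submod.

End Distributions.

(* The dual g[[x]]^* *)
Record distr (F : fieldType) (g : finLieAlgType F) := Distr {
  dfun :> (nat -> g) -> F^o;
  dfunP : dfun \in @is_distr F g }.
Arguments distr {F} g.

HB.instance Definition _ (F : fieldType) (g : finLieAlgType F) :=
  [isSub for @dfun F g].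
HB.instance Definition _ (F : fieldType) (g : finLieAlgType F) :=
  [Choice of distr g by <:].
HB.instance Definition _ (F : fieldType) (g : finLieAlgType F) :=
  [SubChoice_isSubLmodule of distr g by <:].

Section Double.
Variables (F : fieldType) (g : finLieAlgType F).

Definition dbl : Type := ((nat -> g) * distr g)%type.
HB.instance Definition _ := GRing.Lmodule.on dbl.

Definition dbl_form (p q : dbl) : F := q.2 p.1 + p.2 q.1.

(* The defining properties of the bracket of D(g[[x]], deltabar), which
   determine it. *)
Definition is_double_bracket (deltabar : (nat -> g) -> gtens2 g)
    (br : dbl -> dbl -> dbl) : Prop :=
  [/\ lie_bracket_on setT br,
      forall a b, br (a, 0) (b, 0) = (ps_lie a b, 0),
      forall f h : distr g, (br (0, f) (0, h)).1 = 0 /\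
        (forall a, (br (0, f) (0, h)).2 a =
           pairing2 (fun n u => f (gmono n u)) (fun n u => h (gmono n u))
                    (deltabar a)) &
      forall p q r, dbl_form (br p q) r = dbl_form p (br q r)].

End Double.

(* Formal sums \sum_(n : int) f_n x^n; Laurent series in x, resp. in 1/x, are
   those with support bounded below, resp. above.  All the sums over nat or int
   below have finite support on the series they are applied to. *)
Section Laurent.
Variable V : zmodType.
Implicit Types f : int -> V.

Definition laurent f : Prop := exists N : int, forall n, n < N -> f n = 0.
Definition laurent_inv f : Prop := exists N : int, forall n, N < n -> f n = 0.
Definition laurent_poly f : Prop := laurent f /\ laurent_inv f.

(* coefficients of a power series in x, resp. in 1/x *)
Definition of_ps (a : nat -> V) : int -> V :=
  fun n => if n is Posz k then a k else 0.

End Laurent.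

Section Ambient.
Variables (F : fieldType) (g : finLieAlgType F).
Implicit Types (f : int -> g) (c : nat -> F).

Definition laur_lie f1 f2 : int -> g :=
  fun n => \sum_(i \in [set: int]) lie (f1 i) (f2 (n - i)).

(* The Killing form of g((x)) over F((x)): the trace of ad f1 \o ad f2 in the
   F((x))-basis of g((x)) given by a basis of g. *)
Definition killing_laur f1 f2 : int -> F := fun n =>
  \sum_j bcoord j (laur_lie f1 (laur_lie f2 (of_ps (gmono 0 (bas j)))) n).

(* t(x^k) = 0 for k >= 2 and t(x^(1 - k)) = c_k for k >= 0, with c_0 = 1. *)
Definition ttrace c (phi : int -> F) : F :=
  \sum_(k \in [set: nat]) c k * phi (1 - k%:Z).

(* (f, (h, g)) stands for f + (h + g epsilon); g((x)) (+) g[epsilon] is the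
   subspace [laur_eps] of [amb]. *)
Definition amb : Type := ((int -> g) * (g * g))%type.
HB.instance Definition _ := GRing.Lmodule.on amb.

Definition laur_eps : set amb := [set p | laurent p.1].

Definition amb_lie (p q : amb) : amb :=
  (laur_lie p.1 q.1,
   (lie p.2.1 q.2.1, lie p.2.1 q.2.2 + lie p.2.2 q.2.1)).

Definition amb_form c (p q : amb) : F :=
  ttrace c (killing_laur p.1 q.1) - killing p.2.2 q.2.1 - killing p.2.1 q.2.2
  - c 1%N * killing p.2.1 q.2.1.

Definition embed (a : nat -> g) : amb := (of_ps a, (a 0%N, a 1%N)).

(* D(g[[x]], deltabar) = g((x)) (+) g[epsilon] via Phi, where br is the bracket
   of the double. *)
Definition is_double_iso c (br : dbl g -> dbl g -> dbl g)
    (Phi : dbl g -> amb) : Prop :=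
  [/\ linear Phi /\ set_bij setT laur_eps Phi,
      forall p q, Phi (br p q) = amb_lie (Phi p) (Phi q),
      exists2 s : F, s != 0 &
        forall p q, amb_form c (Phi p) (Phi q) = s * dbl_form p q &
      forall a, Phi (a, 0) = embed a].

Definition dual_image (Phi : dbl g -> amb) : set amb :=
  [set Phi (0, f) | f in [set: distr g]].

Definition orth c (W : set amb) : set amb :=
  [set p | laur_eps p /\ forall q, W q -> amb_form c p q = 0].

Definition lagrangian_subalgebra c (W : set amb) : Prop :=
  [/\ is_subspace W, forall p q, W p -> W q -> W (amb_lie p q) & W = orth c W].

(* r = \sum_k r_k x^(-k) in F[[1/x]] *)
Definition inv_scale (r : nat -> F) f : int -> g :=
  fun n => \sum_(k \in [set: nat]) r k *: f (n + k%:Z).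

(* W(F[[1/x]] (+) F) *)
Definition ring_span (W : set amb) : set amb :=
  lspan [set q | exists (r : nat -> F) (s : F) (p : amb),
    W p /\ q = (inv_scale r p.1, (s *: p.2.1, s *: p.2.2))].

(* [pcoef sigma k u] is the coefficient of x^k in sigma(u), u in g. *)
Definition pcoef (sigma : gpoly g -> gpoly g) (k : nat) (u : g) : g :=
  gcoef (sigma (gX 0 u)) k.

Definition aut_laur (sigma : gpoly g -> gpoly g) f : int -> g :=
  fun n => \sum_(k \in [set: nat]) pcoef sigma k (f (n - k%:Z)).

Definition aut_amb (sigma : gpoly g -> gpoly g) (p : amb) : amb :=
  (aut_laur sigma p.1,
   (pcoef sigma 0 p.2.1, pcoef sigma 0 p.2.2 + pcoef sigma 1 p.2.1)).

End Ambient.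

Section OrdersOh.
Variables (F : numFieldType) (g : finLieAlgType F) (H : {vspace g}).
Local Notation dual := 'Hom(subvs_of H, F^o).
Implicit Types (alpha : dual) (t : subvs_of H).

(* m in F((1/x)) with v(m) >= alpha(t); x^n has valuation -n. *)
Definition Mval alpha t : set (int -> F) :=
  [set m | laurent_inv m /\ forall n, m n != 0 -> (alpha t : F) <= (- n)%:~R].

Definition Mroot alpha t : set (int -> g) :=
  lspan [set f | exists (m : int -> F) (u : g),
    [/\ Mval alpha t m, root_space alpha u & f = fun n => m n *: u]].

(* h[[1/x]] *)
Definition hser : set (int -> g) :=
  [set f | forall n, f n \in H /\ (0 < n -> f n = 0)].

Definition Oh t : set (int -> g) :=
  lspan [set f | hser f \/ exists2 alpha, is_root alpha & Mroot alpha t f].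

(* Vertices of the extended Dynkin diagram are numbered by 'I_l.+1, with
   alpha_0 in position ord0 and alpha_(j+1) = tnth alpha j in position
   lift ord0 j; k_0 = 1 and alpha_max = \sum_(j >= 1) k_j alpha_j. *)
Definition marks (alpha : (\dim H).-tuple dual) (k : 'I_(\dim H).+1 -> nat)
  : Prop :=
  k ord0 = 1%N /\
  maximal_root alpha (\sum_j (k (lift ord0 j))%:R *: tnth alpha j).

Definition is_vertex_point (alpha : (\dim H).-tuple dual)
    (k : 'I_(\dim H).+1 -> nat) (i : 'I_(\dim H).+1) t : Prop :=
  if i == ord0 then t = 0
  else forall j, (tnth alpha j t : F) =
                 (if lift ord0 j == i then (k i)%:R^-1 else 0).

End OrdersOh.

(* Main.v *)
(* Let y be the element h_i, let d = 1/c and let tau be the inverse of sigma.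
   If u is an eigenvector of ad y with an eigenvalue b such that b < 1, then
   t(K'(d u, q)) = K(u, q_1) = 0 for every q in O_(alpha_i), because the
   eigenvalues of ad y on q_1 are at most -1 and the Killing form pairs
   eigenvectors nontrivially only for opposite eigenvalues.  As sigma preserves
   K', tau(d u) is orthogonal to W, hence belongs to W = W^orth, and therefore
   d u lies in O_(alpha_i): d_n <> 0 forces b <= -n.  Taking u in the Cartan
   subalgebra (b = 0) gives d = 1, hence c = 1; taking u in the root space of
   alpha_i (b = 1/k_i, n = 0) is contradictory if k_i > 1.  Applied to V and the
   identity instead of W and sigma, the same argument excludes Lagrangian
   subalgebras. *)
From HB Require Import structures.
Require Import Defs.

Set Implicit Arguments.
Unset Strict Implicit.
Unset Printing Implicit Defensive.

Import Order.TTheory GRing.Theory Num.Theory.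
Local Open Scope classical_set_scope.
Local Open Scope ring_scope.

(** * Traces, the Killing form and eigenvectors of ad t *)

Section LieTrace.
Variables (F : fieldType) (g : finLieAlgType F).
Implicit Types (u v w t : g).

HB.instance Definition _ u :=
  GRing.isLinear.Build F g g *:%R (lie u) (fun a v w => lie_linearr a v w u).

Lemma lieDl u v w : lie (u + v) w = lie u w + lie v w.
Proof. by have := lie_linearl 1 u v w; rewrite !scale1r. Qed.

Lemma lieC u v : lie u v = - lie v u.
Proof.
have [_ _ _ alt _] := @lieP F g.
have := alt (u + v) I; rewrite lieDl !linearD /= !alt// add0r addr0.
by move/eqP; rewrite addr_eq0 => /eqP.
Qed.

Lemma lie_jacobi u v w : lie (lie u v) w = lie u (lie v w) - lie v (lie u w).
Proof.
have [_ _ _ _ jac] := @lieP F g.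
have := jac u v w I I I; rewrite (lieC w (lie u v)) (lieC w u) linearN /=.
by move/eqP; rewrite subr_eq0 => /eqP.
Qed.

Lemma bas_decomp u : u = \sum_i bcoord i u *: bas i.
Proof. by rewrite [LHS](coord_vbasis (memvf u)). Qed.

(** Taken on plain functions, so that composites of brackets and coefficient maps need no bundling;
    linearity enters only in [ltraceC]. *)
Definition ltrace (phi : g -> g) : F := \sum_i bcoord i (phi (bas i)).

Lemma eq_ltrace (phi psi : g -> g) : phi =1 psi -> ltrace phi = ltrace psi.
Proof. by move=> e; apply: eq_bigr => i _; rewrite e. Qed.

Lemma ltrace_sum (I : Type) (r : seq I) (phi : I -> g -> g) :
  ltrace (fun w => \sum_(i <- r) phi i w) = \sum_(i <- r) ltrace (phi i).
Proof.
rewrite exchange_big; apply: eq_bigr => j _.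
by rewrite /bcoord linear_sum.
Qed.

Lemma ltraceB (phi psi : g -> g) :
  ltrace (fun w => phi w - psi w) = ltrace phi - ltrace psi.
Proof.
by rewrite /ltrace -sumrB; apply: eq_bigr => i _; rewrite /bcoord linearB.
Qed.

Lemma ltraceC (phi psi : {linear g -> g}) :
  ltrace (phi \o psi) = ltrace (psi \o phi).
Proof.
have E (f h : {linear g -> g}) :
    ltrace (f \o h) = \sum_i \sum_k bcoord k (h (bas i)) * bcoord i (f (bas k)).
  apply: eq_bigr => i _ /=; rewrite [h _ in LHS]bas_decomp linear_sum /bcoord.
  by rewrite linear_sum; apply: eq_bigr => k _; rewrite !linearZ.
rewrite !E exchange_big; apply: eq_bigr => i _; apply: eq_bigr => k _.
exact: mulrC.
Qed.

Lemma killingE u v : killing u v = ltrace (lie u \o lie v).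
Proof. by []. Qed.

Lemma killing_linearr u : linear (killing u : g -> F^o).
Proof.
move=> a v w; rewrite /killing scaler_sumr -big_split; apply: eq_bigr => i _.
by rewrite lie_linearl linearP /bcoord linearP.
Qed.

HB.instance Definition _ u :=
  GRing.isLinear.Build F g F^o *:%R (killing u) (killing_linearr u).

Lemma killingC u v : killing u v = killing v u.
Proof. exact: (ltraceC (lie u) (lie v)). Qed.

Lemma killingZl (a : F) u v : killing (a *: u) v = a * killing u v.
Proof. by rewrite killingC linearZ /= killingC. Qed.

Lemma killing0r v : killing v 0 = 0.
Proof. exact: linear0. Qed.

Lemma killing0l v : killing 0 v = 0.
Proof. by rewrite killingC killing0r. Qed.

Lemma killing_sum_r (I : Type) (r : seq I) (f : I -> g) u :
  killing u (\sum_(i <- r) f i) = \sum_(i <- r) killing u (f i).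
Proof. exact: linear_sum. Qed.

Lemma killing_sum_l (I : Type) (r : seq I) (f : I -> g) v :
  killing (\sum_(i <- r) f i) v = \sum_(i <- r) killing (f i) v.
Proof. by rewrite killingC killing_sum_r; apply: eq_bigr => i _; rewrite killingC. Qed.

(** By Jacobi, ad [t, p] is the commutator of ad t and ad p; the resulting traces of triple products
    agree up to cyclic rotation. *)
Lemma killing_invariant t u v : killing (lie t u) v = - killing u (lie t v).
Proof.
have E (p q : g) : killing (lie t p) q =
    ltrace (lie t \o lie p \o lie q) - ltrace (lie p \o lie t \o lie q).
  by rewrite killingE -ltraceB; apply: eq_ltrace => w /=; rewrite lie_jacobi.
rewrite (killingC u) !E opprB; congr (_ - _).
- exact: etrans (ltraceC (lie t) (lie u \o lie v)) (ltraceC (lie u) (lie v \o lie t)).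
- exact: (ltraceC (lie u) (lie t \o lie v)).
Qed.

Lemma killing_eigen t u v (a b : F) :
  lie t u = a *: u -> lie t v = b *: v -> a + b != 0 -> killing u v = 0.
Proof.
move=> tu tv ab; have := killing_invariant t u v.
rewrite tu tv killingZl linearZ /= => /eqP.
by rewrite -addr_eq0 -mulrDl mulf_eq0 (negPf ab) => /eqP.
Qed.

(** Applying ad t - [az], with [az] the last eigenvalue, removes the last summand and multiplies v
    by the nonzero scalar b - [az]; induction on n finishes. The eigenvalues a_i may repeat. *)
Lemma eigen_sum_neq t v (b : F) n (a : 'I_n -> F) (w : 'I_n -> g) :
  lie t v = b *: v -> (forall i, lie t (w i) = a i *: w i) ->
  (forall i, a i != b) -> v = \sum_i w i -> v = 0.
Proof.
elim: n a w v => [|n IH] a w v tv tw ab; first by rewrite big_ord0.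
rewrite big_ord_recr /=; set z := w ord_max; set az := a ord_max => vE.
have bz : b - az != 0 by rewrite subr_eq0 eq_sym ab.
suff : (b - az) *: v = 0 by move/eqP; rewrite scaler_eq0 (negPf bz) => /eqP.
pose sw (i : 'I_n) := widen_ord (leqnSn n) i.
apply: (IH (a \o sw) (fun i => (a (sw i) - az) *: w (sw i))) => [|i|i|].
- by rewrite linearZ /= tv !scalerA mulrC.
- by rewrite linearZ /= tw !scalerA mulrC.
- exact: ab.
- rewrite scalerBl -tv {1}vE linearD linear_sum /= tw -/z -/az vE scalerDr.
  rewrite opprD addrACA subrr addr0 scaler_sumr -sumrB; apply: eq_bigr => i _.
  by rewrite tw scalerBl.
Qed.

End LieTrace.

(** * Double sums along diagonals and sums of finite support *)

Section FiniteSums.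
Variable V : zmodType.

(** The square is cut along the diagonals m = k + l, and its half N <= k + l contributes nothing.
    This produces the coefficients of c d in [ttrace_inv] and those of a composite of automorphisms
    in [aut_laur_cancel]. *)
Lemma sum_triangle N (B : nat -> nat -> V) :
  (forall k l, (N <= k + l)%N -> B k l = 0) ->
  \sum_(k < N) \sum_(l < N) B k l = \sum_(m < N) \sum_(l < m.+1) B (m - l)%N l.
Proof.
move=> B0; rewrite exchange_big /=.
under [RHS]eq_bigr => m _ do
  rewrite (big_ord_widen_cond N predT (fun l => B (m - l)%N l))//=.
rewrite [RHS](exchange_big_dep predT)//=; apply: eq_bigr => l _.
rewrite -(big_mkord xpredT (fun k => B k l)).
rewrite -(big_mkord (fun m => l < m.+1)%N (fun m => B (m - l)%N l)).
rewrite [RHS](@big_cat_nat _ _ _ l) ?(ltnW (ltn_ord l))//=.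
have -> : \sum_(0 <= m < l | (l < m.+1)%N) B (m - l)%N l = 0.
  rewrite big_nat_cond big_pred0 // => m.
  by rewrite ltnS (leqNgt l); case: (m < l)%N.
rewrite add0r.
have -> : \sum_(l <= m < N | (l < m.+1)%N) B (m - l)%N l = \sum_(0 <= k < N - l) B k l.
  rewrite -{1}[l : nat]add0n big_addn; apply: eq_big => k.
    by rewrite ltnS leq_addl.
  by rewrite addnK.
rewrite (@big_cat_nat _ _ _ (N - l)) ?leq_subr//=.
rewrite [X in _ + X]big_nat_cond [X in _ + X]big1 ?addr0// => k.
by move=> /andP[/andP[Nk _] _]; apply: B0; rewrite addnC -leq_subLR.
Qed.

Lemma fsum_nat N (f : nat -> V) :
  (forall k, (N <= k)%N -> f k = 0) -> \sum_(k \in [set: nat]) f k = \sum_(k < N) f k.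
Proof.
move=> f0; rewrite fsbig_ord.
rewrite [RHS](fsbig_widen _ setT)// => k [_ /= /negP].
by rewrite -leqNgt => /f0.
Qed.

Lemma fsum_int (M : int) L (f : int -> V) :
  (forall i, i < M -> f i = 0) -> (forall i, M + L%:Z <= i -> f i = 0) ->
  \sum_(i \in [set: int]) f i = \sum_(k < L) f (M + k%:Z).
Proof.
move=> lo hi; pose r := [seq M + k%:Z | k <- iota 0 L].
have ur : uniq r.
  by rewrite map_inj_uniq ?iota_uniq// => k l /addrI[].
rewrite -(big_mkord xpredT (fun k => f (M + k%:Z))) /index_iota subn0.
rewrite -(big_map (fun k => M + k%:Z) xpredT f) -/r [RHS]fsbig_seq//.
rewrite [RHS](fsbig_widen _ setT)// => i [_ /= ir].
have [/lo//|Mi] := ltP i M; apply: hi; rewrite leNgt; apply/negP => iL.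
apply: ir; apply/mapP; exists `|i - M|%N.
  by rewrite mem_iota add0n -ltz_nat gez0_abs ?subr_ge0// ltrBlDl.
by rewrite gez0_abs ?subr_ge0// subrKC.
Qed.

Lemma fsum_int1 (n : int) (f : int -> V) :
  (forall i, i != n -> f i = 0) -> \sum_(i \in [set: int]) f i = f n.
Proof.
move=> f0; rewrite (@fsum_int n 1).
- by rewrite big_ord1 addr0.
- by move=> i /lt_eqF/negbT; exact: f0.
- by move=> i; rewrite -ltzD1 ltrD2r => /gt_eqF/negbT; exact: f0.
Qed.

End FiniteSums.

(** * Automorphisms of g[x] through their coefficients *)

Section PolyAut.
Variables (F : fieldType) (g : finLieAlgType F).
Implicit Types (u v w : g) (a b : gpoly g) (sigma tau : gpoly g -> gpoly g).

Lemma gpoly_eq a b : gcoef a =1 gcoef b -> a = b.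
Proof. by move=> ab; apply/val_inj/funext. Qed.

Lemma gcoef_scaleX l a m :
  gcoef (gpoly_scale 'X^l a) m = if (l <= m)%N then gcoef a (m - l) else 0.
Proof.
rewrite /= /conv; case: leqP => lm; last first.
  rewrite big1// => i _; rewrite coefXn; case: eqP => [il|_]; rewrite ?scale0r//.
  by move: (ltn_ord i); rewrite il ltnS leqNgt lm.
have lm' : (l < m.+1)%N by [].
rewrite (bigD1 (Ordinal lm'))//= coefXn eqxx scale1r big1 ?addr0// => i il.
by rewrite coefXn; move: il; rewrite -val_eqE /= => /negPf->; rewrite scale0r.
Qed.

Lemma gpoly_scaleC (x : F) a : gpoly_scale x%:P a = x *: a.
Proof.
apply: gpoly_eq => m; rewrite /= /conv big_ord_recl coefC subn0 big1 ?addr0//.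
by move=> i _; rewrite coefC scale0r.
Qed.

Lemma conv_gmono0 (B : g -> g -> g) u (b : nat -> g) m :
  (forall v, B 0 v = 0) -> conv B (gmono 0 u) b m = B u (b m).
Proof.
by move=> B0; rewrite /conv big_ord_recl subn0 big1 ?addr0.
Qed.

Lemma conv_gmono0r (B : g -> g -> g) (b : nat -> g) u m :
  (forall v, B v 0 = 0) -> conv B b (gmono 0 u) m = B (b m) u.
Proof.
move=> B0; rewrite /conv big_ord_recr /= subnn big1 ?add0r// => i _.
by rewrite /gmono subn_eq0 leqNgt ltn_ord B0.
Qed.

Section OneAut.
Variables (sigma : gpoly g -> gpoly g) (sigmaaut : is_polyAut sigma).

Lemma polyAut_linear (x : F) a b : sigma (x *: a + b) = x *: sigma a + sigma b.
Proof. by have [lin _ _] := sigmaaut; rewrite -!gpoly_scaleC lin. Qed.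

Lemma pcoef_linear k : linear (pcoef sigma k).
Proof.
move=> x u v; rewrite /pcoef.
have -> : gX 0 (x *: u + v) = x *: gX 0 u + gX 0 v.
  by apply: gpoly_eq => -[|m] /=; rewrite !fctE /gmono//= scaler0 addr0.
by rewrite polyAut_linear.
Qed.

HB.instance Definition _ k :=
  GRing.isLinear.Build F g g *:%R (pcoef sigma k) (pcoef_linear k).

Definition pcoefL k : {linear g -> g} := pcoef sigma k.

(** A bound uniform in u exists because g has a finite basis; it turns [aut_laur] into a finite
    sum. *)
Lemma pcoef_bounded : exists D, forall k u, (D <= k)%N -> pcoef sigma k u = 0.
Proof.
have bnd (i : 'I_(\dim {:g})) :
    exists N, forall n, (N <= n)%N -> gcoef (sigma (gX 0 (bas i))) n = 0.
  by have /asboolP := gcoefP (sigma (gX 0 (bas i))).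
have [N NP] := choice bnd.
exists (\max_i N i)%N => k u Nk; rewrite [u]bas_decomp linear_sum big1//= => i _.
by rewrite linearZ /= /pcoef NP ?scaler0// (leq_trans (leq_bigmax i)).
Qed.

(** Being linear over F[x], sigma is determined by its values on constants, so it is applied to the
    expansion of a in powers of x. *)
Lemma gcoef_polyAut a m :
  gcoef (sigma a) m = \sum_(l < m.+1) pcoef sigma (m - l) (gcoef a l).
Proof.
have [lin _ _] := sigmaaut.
have sig0 : sigma 0 = 0.
  have /esym/eqP := polyAut_linear 1 0 0; rewrite !scale1r addr0.
  by rewrite -subr_eq0 addrK => /eqP.
have sumE N (b : nat -> g) :
    gcoef (sigma (\sum_(l < N) gpoly_scale 'X^l (gX 0 (b l)))) m =
    \sum_(l < N) if (l <= m)%N then pcoef sigma (m - l) (b l) else 0.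
  elim: N => [|N IH]; first by rewrite !big_ord0 sig0.
  rewrite !big_ord_recr /= addrC lin addrC -IH -gcoef_scaleX.
  by [].
have /asboolP[N0 a0] := gcoefP a.
(* [N0] lets the expansion reach all of a, and [m.+1] lets it cover every index l <= m of the
   claimed sum. *)
pose N := (N0 + m.+1)%N.
have aE : a = \sum_(l < N) gpoly_scale 'X^l (gX 0 (gcoef a l)).
  apply: gpoly_eq => n.
  have gsum (r : seq 'I_N) (h : 'I_N -> gpoly g) :
      gcoef (\sum_(l <- r) h l) n = \sum_(l <- r) gcoef (h l) n.
    by elim: r => [|l r IH]; rewrite ?big_nil// !big_cons -IH.
  rewrite gsum; have [nN|Nn] := ltnP n N; last first.
    rewrite a0 ?(leq_trans _ Nn) ?leq_addr// big1// => l _.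
    rewrite gcoef_scaleX /= /gmono; case: leqP => //; case: eqP => // nl.
    by move=> _; move: (ltn_ord l) => lN; move: (leq_trans lN Nn); rewrite -subn_gt0 nl.
  rewrite (bigD1 (Ordinal nN))// big1 ?addr0 => [|l ln].
    by rewrite gcoef_scaleX /= leqnn subnn addr0.
  rewrite gcoef_scaleX /= /gmono subn_eq0; case: ltngtP => // ln'.
  by move: ln; rewrite -val_eqE /= ln' eqxx.
rewrite {1}aE sumE -big_mkcond.
rewrite [RHS](big_ord_widen N (fun l => pcoef sigma (m - l) (gcoef a l)))//.
by rewrite leq_addl.
Qed.

End OneAut.

Lemma polyAut_inv sigma : is_polyAut sigma ->
  exists2 tau, is_polyAut tau & cancel tau sigma /\ cancel sigma tau.
Proof.
move=> [lin morph [tau st ts]]; exists tau => //; split; last by exists sigma.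
- by move=> p a b; apply: (can_inj st); rewrite lin !ts.
- by move=> a b; apply: (can_inj st); rewrite morph !ts.
Qed.

Lemma polyAut_id : is_polyAut (@id (gpoly g)).
Proof. by split=> //; exists id. Qed.

Section Cancel.
Variables (sigma tau : gpoly g -> gpoly g).
Hypothesis sigmaaut : is_polyAut sigma.
Hypothesis tauK : cancel tau sigma.

Lemma pcoef_cancel m u :
  \sum_(l < m.+1) pcoef sigma (m - l) (pcoef tau l u) = gmono 0 u m.
Proof. by rewrite -gcoef_polyAut// tauK. Qed.

(** This is ad (sigma v) = sigma (ad v) tau in degree m: the morphism property is applied to v and
    tau w. *)
Lemma lie_pcoef m v w :
  lie (pcoef sigma m v) w =
  \sum_(l < m.+1) pcoef sigma (m - l) (lie v (pcoef tau l w)).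
Proof.
have [_ morph _] := sigmaaut.
have := congr1 (fun a => gcoef a m) (morph (gX 0 v) (tau (gX 0 w))).
rewrite tauK gcoef_polyAut// /= /ps_lie (conv_gmono0r _ _ _ (@lieu0 F g)) => <-.
by apply: eq_bigr => l _; rewrite (conv_gmono0 _ _ _ (@lie0u F g)).
Qed.

End Cancel.

(** Degree m of tr(ad (tau u) ad v) = tr(tau (ad u) sigma (ad v)) = tr((ad u) sigma (ad v) tau) =
    tr(ad u ad (sigma v)). *)
Lemma killing_pcoef sigma tau : is_polyAut sigma -> is_polyAut tau ->
  cancel tau sigma -> cancel sigma tau -> forall m u v,
  killing (pcoef tau m u) v = killing u (pcoef sigma m v).
Proof.
move=> sA tA tauK sigmaK m u v; rewrite !killingE.
transitivity (\sum_(l < m.+1)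
    ltrace (pcoefL tA (m - l) \o (lie u \o (pcoefL sA l \o lie v)))).
  rewrite -ltrace_sum; apply: eq_ltrace => w /=.
  by rewrite (lie_pcoef tA sigmaK).
transitivity (\sum_(l < m.+1)
    ltrace (lie u \o (pcoefL sA (m - l) \o (lie v \o pcoefL tA l)))).
  (* The cyclic move carries the coefficient of tau to the end, where its degree is l instead of m -
     l. *)
  rewrite (reindex_inj rev_ord_inj); apply: eq_bigr => l _ /=.
  rewrite subSS subKn -1?ltnS//.
  exact: (ltraceC (pcoefL tA l) (lie u \o (pcoefL sA (m - l) \o lie v))).
rewrite -ltrace_sum; apply: eq_ltrace => w /=.
by rewrite (lie_pcoef sA tauK) linear_sum.
Qed.

End PolyAut.

(** * Integer windows of summation and inverses of power series *)

Lemma fsum_window (V : zmodType) (M P : int) (f : int -> V) :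
  (forall i, i < M -> f i = 0) -> (forall i, P < i -> f i = 0) ->
  \sum_(i \in [set: int]) f i = \sum_(k < `|(P + 1 - M)%R|%N) f (M + k%:Z).
Proof.
(* If P + 1 < M, then f vanishes identically and the absolute value only adds zero terms. *)
move=> lo hi; apply: fsum_int => // i Li; apply: hi.
rewrite -lezD1 (le_trans _ Li)// -lerBlDl.
by rewrite (le_trans (ler_norm _))// abszE.
Qed.

(** A sum over [int] with infinite support has the default value 0, so additivity is not automatic;
    a window common to all summands secures it. *)
Lemma fsum_exchange (V : zmodType) (M P : int) (I : Type) (r : seq I)
    (f : I -> int -> V) :
  (forall k i, i < M -> f k i = 0) -> (forall k i, P < i -> f k i = 0) ->
  \sum_(i \in [set: int]) \sum_(k <- r) f k i =
  \sum_(k <- r) \sum_(i \in [set: int]) f k i.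
Proof.
move=> lo hi; rewrite (@fsum_window _ M P) => [|i iM|i iP]; last 2 first.
- by rewrite big1// => k _; apply: lo.
- by rewrite big1// => k _; apply: hi.
by rewrite exchange_big; apply: eq_bigr => k _; rewrite -fsum_window; auto.
Qed.

Lemma inv_ps (F : fieldType) (c : nat -> F) : c 0%N = 1 ->
  exists d : nat -> F, forall m, \sum_(l < m.+1) c (m - l)%N * d l = (m == 0%N)%:R.
Proof.
move=> c0.
(* [s n] lists d_0, ..., d_(n-1), and [next] solves the degree n equation of c d = 1 for d_n, using
   c_0 = 1. *)
pose next (s : seq F) :=
  (size s == 0%N)%:R - \sum_(l < size s) c (size s - l)%N * s`_l.
pose s n := iter n (fun s => rcons s (next s)) [::].
have size_s n : size (s n) = n by elim: n => //= n IH; rewrite size_rcons IH.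
pose d n := next (s n).
have sd n l : (l < n)%N -> (s n)`_l = d l.
  elim: n => // n IH; rewrite ltnS leq_eqVlt /= nth_rcons size_s.
  by move=> /orP[/eqP->|ln]; [rewrite ltnn eqxx|rewrite ln IH].
exists d => m; rewrite big_ord_recr /= subnn c0 mul1r {2}/d /next size_s.
rewrite [X in X + _](_ : _ = \sum_(l < m) c (m - l)%N * (s m)`_l) ?subrKC//.
by apply: eq_bigr => l _; rewrite sd.
Qed.

(** * The Killing form of g((x)) and the functional t *)

Section Laurent.
Variables (F : fieldType) (g : finLieAlgType F).
Implicit Types (f q : int -> g) (u v w : g).

Lemma laur_lie_const f w n : laur_lie f (of_ps (gmono 0 w)) n = lie (f n) w.
Proof.
rewrite /laur_lie (@fsum_int1 _ n) ?subrr// => i ni.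
suff -> : of_ps (gmono 0 w) (n - i) = 0 by rewrite lieu0.
case E : (n - i) => [[|k]|k]//=.
by move/eqP: E; rewrite subr_eq0 eq_sym (negPf ni).
Qed.

(** The trace is computed on constant basis vectors, so the inner bracket has a single term in each
    degree and K' is the coefficientwise extension of K. *)
Lemma killing_laurE f q n : laurent f -> laurent q ->
  killing_laur f q n = \sum_(i \in [set: int]) killing (f i) (q (n - i)).
Proof.
move=> [M fM] [N qN].
have qN' i : n - N < i -> q (n - i) = 0.
  by move=> iN; apply: qN; rewrite ltrBlDl -ltrBlDr.
have -> : killing_laur f q n =
    \sum_j bcoord j (\sum_(i \in [set: int]) lie (f i) (lie (q (n - i)) (bas j))).
  apply: eq_bigr => j _; congr bcoord; apply: eq_fsbigr => i _ /=.
  by rewrite laur_lie_const.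
rewrite (@fsum_exchange _ M (n - N)) => [|j i iM|j i iN]; last 2 first.
- by rewrite fM// lie0u /bcoord ?linear0.
- by rewrite qN'// lie0u lieu0 /bcoord ?linear0.
apply: eq_bigr => j _; rewrite !(@fsum_window _ M (n - N)) => [|i iM|i iN|i iM|i iN].
- by rewrite /bcoord linear_sum.
- by rewrite fM// lie0u /bcoord ?linear0.
- by rewrite qN'// lie0u lieu0 /bcoord ?linear0.
- by rewrite fM// lie0u /bcoord ?linear0.
- by rewrite qN'// lie0u lieu0 /bcoord ?linear0.
Qed.

Lemma laurent_of_ps (V : zmodType) (a : nat -> V) : laurent (of_ps a).
Proof. by exists 0 => -[]. Qed.

(** t(phi) is the coefficient of x in c phi, and c cancels against d. *)
Lemma ttrace_inv (c d : nat -> F) u q :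
  (forall m, \sum_(l < m.+1) c (m - l)%N * d l = (m == 0%N)%:R) -> laurent q ->
  ttrace c (killing_laur (of_ps (fun n => d n *: u)) q) = killing u (q 1).
Proof.
(* k + l >= L forces 1 - k - l < N, below the support of q. *)
move=> cd ql; have [N qN] := ql; pose L := `|(1 - N)%R|.+1%N.
have q0 k l : (L <= k + l)%N -> q (1 - k%:Z - l%:Z) = 0.
  move=> Lkl; apply: qN; rewrite -addrA -opprD ltrBlDl -ltrBlDr.
  by rewrite (le_lt_trans (ler_norm _))// -abszE -PoszD ltz_nat.
have phiE k : killing_laur (of_ps (fun n => d n *: u)) q (1 - k%:Z) =
    \sum_(l < L) d l * killing u (q (1 - k%:Z - l%:Z)).
  rewrite killing_laurE//; last exact: laurent_of_ps.
  rewrite (@fsum_int _ 0 L) => [|[l|l]//|[l|l]//].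
  - by apply: eq_bigr => l _; rewrite add0r /= killingZl.
  - by rewrite killing0l.
  - rewrite add0r lez_nat => Ll.
    by rewrite (q0 _ _ (leq_trans Ll (leq_addl k l))) killing0r.
rewrite /ttrace (@fsum_nat _ L) => [|k Lk]; last first.
  rewrite phiE big1 ?mulr0// => l _.
  by rewrite q0 ?killing0r ?mulr0// (leq_trans Lk)// leq_addr.
pose B k l := c k * (d l * killing u (q (1 - k%:Z - l%:Z))).
transitivity (\sum_(k < L) \sum_(l < L) B k l).
  by apply: eq_bigr => k _; rewrite phiE mulr_sumr.
rewrite sum_triangle => [|k l Lkl]; last by rewrite /B q0// killing0r !mulr0.
transitivity (\sum_(m < L) (m == 0 :> nat)%:R * killing u (q (1 - m%:Z))).
  apply: eq_bigr => m _; rewrite -cd mulr_suml; apply: eq_bigr => l _.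
  rewrite /B mulrA -addrA -opprD -PoszD subnK//.
  by rewrite -ltnS.
by rewrite /L big_ord_recl big1 ?mul1r ?addr0 ?subr0// => i _; rewrite mul0r.
Qed.

End Laurent.

(** * Automorphisms acting on Laurent series *)

Section AutLaurent.
Variables (F : fieldType) (g : finLieAlgType F).
Variables (sigma tau : gpoly g -> gpoly g).
Hypotheses (sigmaaut : is_polyAut sigma) (tauaut : is_polyAut tau).
Hypotheses (tauK : cancel tau sigma) (sigmaK : cancel sigma tau).
Implicit Types (f q : int -> g).

Lemma aut_laurE rho D f n : (forall k u, (D <= k)%N -> pcoef rho k u = 0) ->
  aut_laur rho f n = \sum_(k < D) pcoef rho k (f (n - k%:Z)).
Proof. by move=> rho0; apply: fsum_nat => k /rho0. Qed.

Lemma laurent_aut rho f : is_polyAut rho -> laurent f -> laurent (aut_laur rho f).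
Proof.
move=> rA [N fN]; have [D rD] := pcoef_bounded rA.
exists N => n nN; rewrite (aut_laurE _ _ rD) big1// => k _.
rewrite fN ?(le_lt_trans _ nN) ?gerBl//.
exact: (linear0 (pcoefL rA k)).
Qed.

Lemma aut_laur_cancel f : aut_laur sigma (aut_laur tau f) = f.
Proof.
have [D1 sD] := pcoef_bounded sigmaaut; have [D2 tD] := pcoef_bounded tauaut.
(* k + l >= E forces k >= D1 or l >= D2; the successor guarantees that the term m = 0, the only
   surviving one, is present. *)
pose E := (D1 + D2).+1.
have sE k u : (E <= k)%N -> pcoef sigma k u = 0.
  by move=> Ek; apply: sD; rewrite (leq_trans _ Ek)// leqW// leq_addr.
have tE k u : (E <= k)%N -> pcoef tau k u = 0.
  by move=> Ek; apply: tD; rewrite (leq_trans _ Ek)// leqW// leq_addl.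
apply/funext => n; rewrite (aut_laurE _ _ sE).
pose B k l := pcoef sigma k (pcoef tau l (f (n - (k + l)%:Z))).
transitivity (\sum_(k < E) \sum_(l < E) B k l).
  apply: eq_bigr => k _; rewrite (aut_laurE _ _ tE).
  rewrite (linear_sum (pcoefL sigmaaut k)); apply: eq_bigr => l _ /=.
  by rewrite /B PoszD opprD addrA.
rewrite sum_triangle => [|k l Ekl]; last first.
  rewrite /B; have [Dk|kD] := leqP D1 k; first exact: sD.
  rewrite tD ?(linear0 (pcoefL sigmaaut k))//.
  by have := leq_trans (ltnW Ekl) (leq_add (ltnW kD) (leqnn l)); rewrite leq_add2l.
transitivity (\sum_(m < E) gmono 0 (f (n - m%:Z)) m).
  apply: eq_bigr => m _; rewrite -(pcoef_cancel sigmaaut tauK).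
  by apply: eq_bigr => l _; rewrite /B subnK// -ltnS.
by rewrite /E big_ord_recl big1 ?addr0 /gmono /= ?subr0.
Qed.

(** The adjointness of [killing_pcoef], summed over all degrees. *)
Lemma killing_laur_aut f q : laurent f -> laurent q ->
  killing_laur (aut_laur tau f) q = killing_laur f (aut_laur sigma q).
Proof.
move=> fl ql; apply/funext => n.
rewrite !killing_laurE//; try exact: laurent_aut.
have [D1 sD] := pcoef_bounded sigmaaut; have [D2 tD] := pcoef_bounded tauaut.
pose E := (D1 + D2)%N.
have sE k u : (E <= k)%N -> pcoef sigma k u = 0.
  by move=> Ek; apply: sD; rewrite (leq_trans _ Ek)// leq_addr.
have tE k u : (E <= k)%N -> pcoef tau k u = 0.
  by move=> Ek; apply: tD; rewrite (leq_trans _ Ek)// leq_addl.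
have [M fM] := fl; have [N qN] := ql.
pose h k i := killing (f (i - k%:Z)) (pcoef sigma k (q (n - i))).
pose h' k i := killing (f i) (pcoef sigma k (q (n - i - k%:Z))).
transitivity (\sum_(i \in [set: int]) \sum_(k < E) h k i).
  apply: eq_fsbigr => i _; rewrite (aut_laurE _ _ tE) killing_sum_l.
  by apply: eq_bigr => k _; rewrite (killing_pcoef sigmaaut tauaut).
rewrite (@fsum_exchange _ M (n - N)) => [|k i iM|k i iN]; last 2 first.
- by rewrite /h fM ?killing0l// (le_lt_trans _ iM)// gerBl.
- rewrite /h qN ?(linear0 (pcoefL sigmaaut k)) ?killing0r//.
  by rewrite ltrBlDl -ltrBlDr.
transitivity (\sum_(i \in [set: int]) \sum_(k < E) h' k i); last first.
  by apply: eq_fsbigr => i _; rewrite (aut_laurE _ _ sE) killing_sum_r.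

rewrite (@fsum_exchange _ M (n - N)) => [|k i iM|k i iN]; last 2 first.
- by rewrite /h' fM ?killing0l.
- rewrite /h' qN ?(linear0 (pcoefL sigmaaut k)) ?killing0r//.
  by rewrite (@le_lt_trans _ _ (n - i)) ?gerBl// ltrBlDl -ltrBlDr.
(* The factor x^k passes from f to q, which is the shift of i by k. *)
apply: eq_bigr => k _; rewrite (@reindex_fsbigT _ _ _ _ _ (fun i => i + k%:Z)).
  by apply: eq_fsbigr => i _; rewrite /h /h' addrK opprD addrA.
by exists (fun i => i - k%:Z) => i; rewrite ?addrK ?subrK.
Qed.

End AutLaurent.

(** * Linear spans *)

Section Span.
Variables (F : fieldType) (V : lmodType F).
Implicit Types A B : set V.

Lemma lspan_sub A B : is_subspace B -> A `<=` B -> lspan A `<=` B.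
Proof.
move=> [B0 BP] AB v [n [a [w [wA ->]]]].
elim/big_rec: _ => // i x _; apply: BP; exact: AB.
Qed.

Lemma sub_lspan A : A `<=` lspan A.
Proof.
move=> v Av; exists 1%N, (fun=> 1), (fun=> v); split=> //.
by rewrite big_ord1 scale1r.
Qed.

Lemma lspan_subspace A : is_subspace (lspan A).
Proof.
split=> [|x u v [m [a [w [wA ->]]]] [n [b [z [zA ->]]]]].
  by exists 0%N, (fun=> 0), (fun=> 0); split=> [[]//|]; rewrite big_ord0.
exists (m + n)%N,
  (fun i : 'I_(m + n) => match fintype.split i with inl j => x * a j | inr j => b j end),
  (fun i : 'I_(m + n) => match fintype.split i with inl j => w j | inr j => z j end).
split=> [i|]; first by case: (fintype.split i).
rewrite big_split_ord scaler_sumr; congr (_ + _); apply: eq_bigr => i _.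
  by rewrite (unsplitK (inl i)) scalerA.
by rewrite (unsplitK (inr i)).
Qed.

End Span.

(** * Eigenvalue bounds on the coefficients of elements of O_h *)

Section EigenBound.
Variables (F : numFieldType) (g : finLieAlgType F).
Implicit Types (u v w y : g) (b : F).

(** Its span is the sum of the eigenspaces of ad y with eigenvalue at most b. The order of F may be
    partial, hence the negated inequalities below in place of strict ones. *)
Definition eigen_le y b : set g :=
  [set w | exists2 a : F, a <= b & lie y w = a *: w].

(** Otherwise every eigenvalue in a decomposition of u differs from a, and [eigen_sum_neq] gives u =
    0. *)
Lemma eigen_le_mem y a b u :
  lie y u = a *: u -> u != 0 -> lspan (eigen_le y b) u -> a <= b.
Proof.
move=> yu u0 [n [x [w [wE uE]]]]; apply/idP; apply: contraTT u0 => ab.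
have wE' i : exists e, e <= b /\ lie y (w i) = e *: w i.
  by have [e eb yw] := wE i; exists e.
have [e eP] := choice wE'.
rewrite negbK; apply/eqP; apply: (eigen_sum_neq yu _ _ uE) => i.
  by have [_ yw] := eP i; rewrite linearZ /= yw !scalerA mulrC.
by have [eb _] := eP i; apply: contraNneq ab => <-.
Qed.

Lemma killing_eigen_le y a b u v : ~~ (- a <= b) ->
  lie y u = a *: u -> lspan (eigen_le y b) v -> killing u v = 0.
Proof.
move=> ab yu; apply: (@lspan_sub _ _ _ [set v | killing u v = 0]) => [|w [e eb yw] /=].
  split=> [|x w z /= uw uz]; first exact: killing0r.
  by rewrite (killing_linearr u x w z) uw uz scaler0 addr0.
apply: (killing_eigen yu yw); apply: contraNneq ab => /eqP.
by rewrite addr_eq0 => /eqP->; rewrite opprK.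
Qed.

(** As x^n has valuation -n, it may multiply a root vector of alpha only if alpha(t) <= -n. On the
    Cartan part the eigenvalue is 0 and n <= 0. *)
Lemma Oh_eigen (H : {vspace g}) (t : subvs_of H) f :
  (forall v, v \in H -> lie (vsval t) v = 0) -> Oh t f ->
  forall n, lspan (eigen_le (vsval t) (- n)%:~R) (f n).
Proof.
move=> tH; pose B : set (int -> g) :=
  [set f | forall n, lspan (eigen_le (vsval t) (- n)%:~R) (f n)].
have Bsub : is_subspace B.
  split=> [n|x p q Bp Bq n]; first by have [] := lspan_subspace (eigen_le (vsval t) (- n)%:~R).
  by have [_] := lspan_subspace (eigen_le (vsval t) (- n)%:~R); apply.
suff : Oh t `<=` B by move=> sub /sub.
apply: (lspan_sub Bsub) => {}f [fH n|[al _]].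
  have [fnH f0] := fH n; have [n0|n0] := ltP 0 n.
    by rewrite f0//; have [] := lspan_subspace (eigen_le (vsval t) (- n)%:~R).
  by apply: sub_lspan; exists 0; rewrite ?ler0z ?oppr_ge0// tH// scale0r.
suff : Mroot al t `<=` B by apply.
apply: (lspan_sub Bsub) => {}f [m [u [[_ mP] ru ->]]] n.
have [m0|m0] := eqVneq (m n) 0.
  by rewrite m0 scale0r; have [] := lspan_subspace (eigen_le (vsval t) (- n)%:~R).
apply: sub_lspan; exists (al t); first exact: mP.
by rewrite linearZ /= ru !scalerA mulrC.
Qed.

(** U and sigma are kept general to cover both W with sigma and a Lagrangian V with the identity. *)
Lemma lagrangian_in_Oh (H : {vspace g}) (t : subvs_of H) (c d : nat -> F)
    (U : set (amb g)) sigma u b :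
  (forall v, v \in H -> lie (vsval t) v = 0) ->
  (forall m, \sum_(l < m.+1) c (m - l)%N * d l = (m == 0%N)%:R) ->
  U = orth c U -> is_polyAut sigma ->
  (forall p, U p -> Oh t (aut_laur sigma p.1)) ->
  lie (vsval t) u = b *: u -> u != 0 -> ~~ (1 <= b) ->
  forall n, d n != 0 -> b <= - n%:R.
Proof.
move=> tH cd UE sA UO yu u0 b1 n dn.
have [tau tA [tauK sigmaK]] := polyAut_inv sA.
pose f := of_ps (fun n => d n *: u).
have fl : laurent f by apply: laurent_of_ps.
(* With zero component in g[epsilon], only the term t(K') of the form remains; adjointness moves tau
   onto q as sigma. *)
have fU : U (aut_laur tau f, (0, 0)).
  rewrite UE; split; first exact: laurent_aut.
  move=> q Uq; have ql : laurent q.1 by move: Uq; rewrite UE => -[].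
  rewrite /amb_form /= !killing0l mulr0 !subr0.
  rewrite (killing_laur_aut sA tA)// ttrace_inv//; last exact: laurent_aut.
  apply: (killing_eigen_le _ yu (Oh_eigen tH (UO q Uq) 1)).
  by rewrite lerNl mulrNz opprK.
(* sigma undoes tau, so the coefficient of x^n to be bounded is d_n u. *)
have := Oh_eigen tH (UO _ fU) n%:Z.
rewrite (aut_laur_cancel sA tA tauK) /= mulrNz.
by apply: eigen_le_mem; rewrite ?scaler_eq0 ?negb_or ?dn// linearZ /= yu !scalerA mulrC.
Qed.

End EigenBound.

(** * Commutativity of the Cartan subalgebra *)

Section Cartan.
Variables (F : fieldType) (g : finLieAlgType F) (H : {vspace g}).
Local Notation dual := 'Hom(subvs_of H, F^o).

(** On a root vector s and t act by scalars, so their commutator acts by zero. *)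
Lemma root_lie (beta : dual) (s t : subvs_of H) (r : subvs_of H) :
  is_root beta -> vsval r = lie (vsval s) (vsval t) -> beta r = 0.
Proof.
move=> [_ [u u0 ub]] rE; have := lie_jacobi (vsval s) (vsval t) u.
rewrite -rE !ub !linearZ /= !ub scalerN !scalerA mulrC subrr => /eqP.
by rewrite scaler_eq0 (negPf u0) orbF => /eqP.
Qed.

Lemma dual_separates (s : subvs_of H) : (forall beta : dual, beta s = 0) -> s = 0.
Proof.
move=> s0; rewrite [s](coord_vbasis (memvf s)) big1// => i _.
have /= := s0 (linfun (coord (vbasis {:subvs_of H}) i : subvs_of H -> F^o)).
by rewrite lfunE /= => ->; rewrite scale0r.
Qed.

(* The commutator of two elements of [H] is killed by every root, and the
   simple roots span the dual of [H]. *)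
Lemma cartan_abelian (alpha : (\dim H).-tuple dual) :
  is_cartan H -> simple_roots alpha ->
  forall s t, s \in H -> t \in H -> lie s t = 0.
Proof.
move=> [HH _ _] [alpha_basis alpha_root _] s t sH tH.
have stH : lie s t \in H.
  rewrite [s](coord_vbasis sH) [t](coord_vbasis tH).
  have mem_lie (i j : 'I_(\dim H)) : lie (vbasis H)`_i (vbasis H)`_j \in H.
    by apply: (subvP HH); apply: memv_span; apply: allpairs_f; apply: mem_nth; rewrite size_tuple.
  rewrite (linear_sum (lie _)) rpred_sum// => j _; rewrite linearZ /= rpredZ//.
  rewrite lieC rpredN (linear_sum (lie _)) rpred_sum// => l _; rewrite linearZ /= rpredZ//.
pose r := vsproj H (lie s t).
have rE : vsval r = lie (vsval (vsproj H s)) (vsval (vsproj H t)).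
  by rewrite !vsprojK.
suff r0 : r = 0 by rewrite -(vsprojK stH) -/r r0.
apply: dual_separates => beta.
have /span_basis := alpha_basis; have := memvf beta => + bE.
rewrite -bE => /coord_span ->; rewrite sum_lfunE big1// => j _.
rewrite scale_lfunE -tnth_nth (root_lie (alpha_root j) rE).
exact: scaler0.
Qed.

End Cartan.

(** * The image of the dual as a Lagrangian subspace *)

Section DualImage.
Variables (F : fieldType) (g : finLieAlgType F).

Lemma coef_distr_subproof (n : nat) (i : 'I_(\dim {:g})) :
  (fun a => bcoord i (a n) : F^o) \in @is_distr F g.
Proof.
apply/asboolP; split=> [x a b|].
  by rewrite /bcoord /= !fctE linearP.
by exists n.+1 => a a0; rewrite a0// /bcoord linear0.
Qed.

Lemma distr_separates (a : nat -> g) : (forall f : distr g, f a = 0) -> a = 0.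
Proof.
move=> fa; apply/funext => n; rewrite [a n]bas_decomp big1// => i _.
by have /= -> := fa (Distr (coef_distr_subproof n i)); rewrite scale0r.
Qed.

(** Phi preserves forms up to a nonzero scalar. The dual is isotropic in the double, and if (a, f)
    is orthogonal to it, every distribution vanishes at a, whence a = 0. *)
Lemma dual_image_orth c br (Phi : dbl g -> amb g) : is_double_iso c br Phi ->
  dual_image Phi = orth c (dual_image Phi).
Proof.
move=> [[_ [PhiS _ PhiT]] _ [s s0 form] _].
have distr0 (f : distr g) : f 0 = 0.
  have /asboolP[flin _] := dfunP f.
  by have := flin (-1) 0 0; rewrite scaler0 addr0 scaleN1r addNr.
apply/seteqP; split=> [p [f _ <-]|p [pl pW]].
  split; first exact: PhiS.
  by move=> q [h _ <-]; rewrite form /dbl_form /= !distr0 addr0 mulr0.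
have [[a f] _ pE] := PhiT p pl.
suff a0 : a = 0 by exists f => //; rewrite -pE a0.
apply: distr_separates => h.
have := pW _ (imageT _ h); rewrite -pE form /dbl_form /= distr0 addr0 => /eqP.
by rewrite mulf_eq0 (negPf s0) => /eqP.
Qed.

Lemma sub_ring_span (W : set (amb g)) : W `<=` ring_span W.
Proof.
move=> p Wp; apply: sub_lspan; exists (fun k => (k == 0%N)%:R), 1, p; split=> //.
case: p Wp => f [u v] _ /=; rewrite !scale1r; congr (_, _); apply/funext => n.
rewrite /inv_scale (@fsum_nat _ 1) => [|[]// k _]; last by rewrite scale0r.
by rewrite big_ord1 scale1r addr0.
Qed.

End DualImage.

(** * The cases k_i = 1 and k_i > 1 *)

Theorem theorem4p19 (R : realType) (g : finLieAlgType R[i])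
    (gsimple : simple_lie g)
    (H : {vspace g}) (Hcartan : is_cartan H)
    (alpha : (\dim H).-tuple 'Hom(subvs_of H, R[i]^o))
    (alphasimple : simple_roots alpha)
    (k : 'I_(\dim H).+1 -> nat) (kmarks : marks alpha k)
    (delta : gpoly g -> gtens2 g) (deltabialg : is_bialgebra delta)
    (c : nat -> R[i]) (c0 : c 0%N = 1)
    (br : dbl g -> dbl g -> dbl g)
    (brdouble : is_double_bracket (delta_ext delta) br)
    (Phi : dbl g -> amb g) (Phiiso : is_double_iso c br Phi)
    (W : set (amb g)) (WE : W = dual_image Phi)
    (sigma : gpoly g -> gpoly g) (sigmaaut : is_polyAut sigma)
    (i : 'I_(\dim H).+1) (hi : subvs_of H)
    (hiE : is_vertex_point alpha k i hi)
    (sigmaW : forall p, ring_span W p -> Oh hi (aut_amb sigma p).1) :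
  [/\ k i = 1%N -> forall n, (0 < n)%N -> c n = 0,
      (1 < k i)%N ->
        ~ exists2 V : set (amb g), lagrangian_subalgebra c V &
            forall p, V p -> Oh hi p.1 /\ laurent_poly p.1 &
      ~ (1 < k i)%N].
Proof.
have Hab := cartan_abelian Hcartan alphasimple.
have hiH v : v \in H -> lie (vsval hi) v = 0 by apply: Hab; exact: subvsP.
have [d cd] := inv_ps c0.
have d0 : d 0%N = 1 by have := cd 0%N; rewrite big_ord1 c0 mul1r.
have Worth : W = orth c W by rewrite WE; exact: dual_image_orth Phiiso.
have WO p : W p -> Oh hi (aut_laur sigma p.1).
  by move=> /sub_ring_span; exact: sigmaW.
have k_gt1 U rho : (1 < k i)%N -> U = orth c U -> is_polyAut rho ->
    (forall p, U p -> Oh hi (aut_laur rho p.1)) -> False.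
  move=> ki UE rA UO; have [k0 _] := kmarks.
  (* k_0 = 1 rules out alpha_0, so the vertex is a simple root. *)
  case: (unliftP ord0 i) => [j ij|i0]; last by rewrite i0 k0 in ki.
  have hij : tnth alpha j hi = (k i)%:R^-1.
    move: hiE; rewrite /is_vertex_point {1}ij eq_sym (negPf (neq_lift _ _)).
    by move=> ->; rewrite ij eqxx.
  have [_ /(_ j)[_ [u u0 uj]] _] := alphasimple.
  (* The eigenvalue 1/k_i is less than 1, and d_0 = 1 would force 1/k_i <= 0. *)
  have := lagrangian_in_Oh hiH cd UE rA UO (uj hi) u0 _ (n := 0%N).
  rewrite hij d0 oppr0 oner_eq0 invr_le0 lern0 -leqn0 leqNgt (ltnW ki) => /(_ _ isT).
  have kn : 0 < (k i)%:R :> R[i] by rewrite ltr0n ltnW.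
  by rewrite invf_ge1// lern1 -ltnNge ki => /(_ isT).
split=> [_ n n0||ki].
(* If H were zero, its dual would contain no nonzero functional, but the maximal root is one. *)
- have [v vH v0] : exists2 v, v \in H & v != 0.
    have [_ [[theta0 _] _]] := kmarks.
    case: (eqVneq H 0%VS) => [H0|]; last first.
      by move=> H0; exists (vpick H); rewrite ?memv_pick ?vpick0.
    case/eqP: theta0; apply/lfunP => t; rewrite lfunE /=.
    suff -> : t = 0 by rewrite linear0.
    by apply/val_inj/eqP; move: (subvsP t); rewrite -memv0; apply: subvP; rewrite H0.
  have dn m : (0 < m)%N -> d m = 0.
    move=> m0; apply/eqP; apply: contraTT (isT) => dm.
    have v00 : lie (vsval hi) v = 0 *: v by rewrite hiH// scale0r.
    (* With eigenvalue 0, a nonzero d_m would give 0 <= -m. *)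
    have := lagrangian_in_Oh hiH cd Worth sigmaaut WO v00 v0 _ dm.
    by rewrite ler10 oppr_ge0 lern0 -leqn0 leqNgt m0 => /(_ isT).
  have := cd n; rewrite big_ord_recl d0 mulr1 subn0 big1 ?addr0 => [->|l _].
    by rewrite gtn_eqF.
  by rewrite dn// mulr0.
- move=> ki [V [_ _ VE] VO]; apply: (k_gt1 V id ki VE (polyAut_id g)) => p Vp.
  have -> : aut_laur id p.1 = p.1; last by have [] := VO p Vp.
  apply/funext => n; rewrite /aut_laur (@fsum_nat _ 1) => [|[]//].
  by rewrite big_ord1 subr0.
- exact: (k_gt1 W sigma ki Worth sigmaaut WO).
Qed.
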